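(* Let $s\in\mathbb{N}$ and let $B,G\in\mathbb{R}^{s\times s}$ be the coefficient matrices of a stiffly accurate peer two-step method (that is, with $A=0$). If there exist a symmetric positive definite matrix $Z\in\mathbb{R}^{s\times s}$ and a symmetric positive semi-definite matrix $W\in\mathbb{R}^{s\times s}$ such that the matrix $$\mathbb{M}:=\begin{pmatrix} G^{\sf T}Z+ZG-W & -G^{\sf T}ZB\\ -B^{\sf T}ZG & W\end{pmatrix}\in\mathbb{R}^{2s\times 2s}$$ is positive semi-definite, then the peer method is A-stable.
   Context: A peer two-step method with $s$ stages and constant stepsize $h$ for $y'=f(y)$, $f:\mathbb{R}^n\to\mathbb{R}^n$, is the recursion $Y_m-hGF_m=BY_{m-1}+hAF_{m-1}$, where $Y_m\in\mathbb{R}^{s\times n}$ has rows $Y_{m1}^{\sf T},\ldots,Y_{ms}^{\sf T}$ (the stages), $F_m\in\mathbb{R}^{s\times n}$ has rows $f(Y_{mi})^{\sf T}$, and $A,B,G\in\mathbb{R}^{s\times s}$ are the coefficient matrices. It is called stiffly accurate if $A=0$. Applied to $y'=\lambda y$ with $z=h\lambda$ a stiffly accurate method gives $Y_m=\mathbf{M}(z)Y_{m-1}$ with the stability matrix $\mathbf{M}(z)=(I-zG)^{-1}B$. Let $\mathbb{C}_-=\{z\in\mathbb{C}:\Re z<0\}$. The method is called A-stable if $\varrho(\mathbf{M}(z))<1$ for all $z\in\mathbb{C}_-$, where $\varrho$ denotes the spectral radius.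
   Formalization: The coefficient matrix G is additionally assumed nonsingular; without this the claim fails, e.g. s=1, G=0, B=1, Z=1, W=0 gives a zero (positive semi-definite) block matrix but M(z)=1, so the spectral radius is 1. *)

(* Defs.v *)
From HB Require Import structures.
From mathcomp Require Import all_boot all_order all_algebra.
From mathcomp Require Import complex.
From mathcomp Require Import boolp classical_sets reals.

Set Implicit Arguments.
Unset Strict Implicit.
Unset Printing Implicit Defensive.

Import Order.TTheory GRing.Theory Num.Theory.
Local Open Scope classical_set_scope.
Local Open Scope ring_scope.
Local Open Scope complex_scope.

Definition posdef (R : realType) (n : nat) (S : 'M[R]_n) : Prop :=
  S^T = S /\ forall x : 'cV[R]_n, x != 0 -> 0 < (x^T *m S *m x) 0 0.

Definition possemidef (R : realType) (n : nat) (S : 'M[R]_n) : Prop :=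
  S^T = S /\ forall x : 'cV[R]_n, 0 <= (x^T *m S *m x) 0 0.

(* [eigenvalue] refers to row eigenvectors, which yield the same spectrum as
   column eigenvectors. The set below is finite, and nonempty if [0 < n], so
   [sup] is the maximal modulus (and 0 if [n = 0]). *)
Definition spectral_radius (R : realType) (n : nat) (M : 'M[R[i]]_n) : R :=
  sup [set ComplexField.Normc.normc a | a in [set a : R[i] | eigenvalue M a]].

(* Coefficients of the recursion Y_m - h G F_m = B Y_(m-1) + h A F_(m-1). *)
Record peer_method (R : realType) (s : nat) := PeerMethod {
  peerA : 'M[R]_s;
  peerB : 'M[R]_s;
  peerG : 'M[R]_s
}.

Definition complex_mx (R : realType) (m n : nat) (M : 'M[R]_(m, n)) :
  'M[R[i]]_(m, n) := map_mx (real_complex R) M.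

Definition stiffly_accurate (R : realType) (s : nat) (P : peer_method R s) :
  Prop := peerA P = 0.

(* I - z G, the matrix to be inverted in one step for y' = lambda y. *)
Definition stage_mx (R : realType) (s : nat) (P : peer_method R s)
  (z : R[i]) : 'M[R[i]]_s := 1%:M - z *: complex_mx (peerG P).

(* Obtained from the recursion with h F_m = z Y_m. *)
Definition stability_mx (R : realType) (s : nat) (P : peer_method R s)
  (z : R[i]) : 'M[R[i]]_s :=
  invmx (stage_mx P z) *m (complex_mx (peerB P) + z *: complex_mx (peerA P)).

Lemma stability_mx_stiffly_accurate (R : realType) (s : nat)
  (P : peer_method R s) (z : R[i]) : stiffly_accurate P ->
  stability_mx P z =
    invmx (1%:M - z *: complex_mx (peerG P)) *m complex_mx (peerB P).
Proof.
by rewrite /stability_mx => ->; rewrite /complex_mx map_mx0 scaler0 addr0.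
Qed.

(* [invmx] is the identity on singular matrices, so the existence of the
   inverse in the stability matrix has to be required explicitly. *)
Definition A_stable (R : realType) (s : nat) (P : peer_method R s) : Prop :=
  forall z : R[i], complex.Re z < 0 ->
    stage_mx P z \in unitmx /\ spectral_radius (stability_mx P z) < 1.

Definition lmi_mx (R : realType) (s : nat) (B G Z W : 'M[R]_s) :
  'M[R]_(s + s) :=
  block_mx (G^T *m Z + Z *m G - W) (- (G^T *m Z *m B))
           (- (B^T *m Z *m G))     W.

(* Main.v *)
(** If [M(z) v = mu v], then [Y = mu v] satisfies [Y = z G Y + B v], and testing
    the matrix inequality on the pair [(Y, v)] gives
    [2 Re z (GY)^* Z (GY) - Y^* W Y + v^* W v >= 0].  As [Re z < 0], [Z] is
    positive definite and [G] is invertible, this forces [Y = 0] as soon as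
    [v^* W v <= Y^* W Y], which holds if [|mu| >= 1].  The same argument with
    the pair [(Y, 0)] shows that [I - z G] is invertible. *)

Require Import Defs.
From mathcomp Require Import all_boot all_order all_algebra.
From mathcomp Require Import complex.
From mathcomp Require Import boolp classical_sets reals.
From mathcomp Require Import ring lra.

Import Order.TTheory GRing.Theory Num.Theory.
Local Open Scope ring_scope.

Section BilinearForm.
Context {R : realType} {n : nat}.
Implicit Types (S : 'M[R]_n) (x y : 'cV[R]_n).

Definition bilform S x y : R := (x^T *m S *m y) 0 0.

Lemma bilformDl S x x' y : bilform S (x + x') y = bilform S x y + bilform S x' y.
Proof. by rewrite /bilform raddfD /= !mulmxDl mxE. Qed.

Lemma bilformDr S x y y' : bilform S x (y + y') = bilform S x y + bilform S x y'.
Proof. by rewrite /bilform mulmxDr mxE. Qed.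

Lemma bilformZl S k x y : bilform S (k *: x) y = k * bilform S x y.
Proof. by rewrite /bilform linearZ /= -!scalemxAl mxE. Qed.

Lemma bilformZr S k x y : bilform S x (k *: y) = k * bilform S x y.
Proof. by rewrite /bilform -scalemxAr mxE. Qed.

Lemma bilformNr S x y : bilform S x (- y) = - bilform S x y.
Proof. by rewrite /bilform mulmxN mxE. Qed.

Lemma bilformNl S x y : bilform S (- x) y = - bilform S x y.
Proof. by rewrite -scaleN1r bilformZl mulN1r. Qed.

Lemma bilformC S x y : S^T = S -> bilform S x y = bilform S y x.
Proof.
move=> S_sym; rewrite /bilform.
have -> : x^T *m S *m y = (y^T *m S *m x)^T.
  by rewrite !trmx_mul trmxK S_sym mulmxA.
by rewrite mxE.
Qed.

Definition bilformE :=
  (bilformDl, bilformDr, bilformNl, bilformNr, bilformZl, bilformZr).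

Lemma posdef_ge0 S x : posdef S -> 0 <= bilform S x x.
Proof.
move=> [_ S_gt0]; have [->|/S_gt0/ltW //] := eqVneq x 0.
by rewrite /bilform mulmx0 mxE.
Qed.

Lemma posdef_eq0 S x : posdef S -> bilform S x x <= 0 -> x = 0.
Proof.
move=> [_ S_gt0] Sx_le0; apply/eqP/negP => /negP/S_gt0.
by rewrite ltNge Sx_le0.
Qed.

End BilinearForm.

(** Symmetry of [Z] makes each block product equal to its transposed partner. The diagonal terms
    then give twice the pairing of [G *m a] with [a], the off-diagonal ones minus twice its pairing
    with [B *m b]. *)
Lemma bilform_lmi (R : realType) (s : nat) (B G Z W : 'M[R]_s) (a b : 'cV[R]_s) :
  Z^T = Z ->
  bilform (lmi_mx B G Z W) (col_mx a b) (col_mx a b) =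
    bilform Z (G *m a) (a - B *m b) *+ 2 - bilform W a a + bilform W b b.
Proof.
move=> Z_sym; rewrite !bilformE mulrnBl !mulr2n.
(* One copy of each doubled term is flipped to match the transposed block. *)
rewrite {2}(bilformC _ (G *m a) a Z_sym) {2}(bilformC _ (G *m a) (B *m b) Z_sym).
rewrite /bilform /lmi_mx tr_col_mx mul_row_block mul_row_col.
rewrite !(mulmxDr, mulmxDl, mulmxN, mulNmx, trmx_mul, mulmxA).
by rewrite !mxE; ring.
Qed.

(** The two equations are the real and imaginary parts of [a - B b = z G a]. When the inequalities
    for both parts are added, the [zi] terms cancel by symmetry of [Z], and only [zr] times a
    nonnegative quantity remains besides the [W] terms. *)
Lemma lmi_kernel (R : realType) (s : nat) (B G Z W : 'M[R]_s) (zr zi : R)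
    (a1 a2 b1 b2 : 'cV[R]_s) :
  posdef Z -> possemidef (lmi_mx B G Z W) -> zr < 0 ->
  a1 - B *m b1 = zr *: (G *m a1) - zi *: (G *m a2) ->
  a2 - B *m b2 = zr *: (G *m a2) + zi *: (G *m a1) ->
  bilform W b1 b1 + bilform W b2 b2 <= bilform W a1 a1 + bilform W a2 a2 ->
  G *m a1 = 0 /\ G *m a2 = 0.
Proof.
move=> Z_pd [_ lmi_ge0] zr_lt0 eq1 eq2 leW.
have Z_sym : Z^T = Z by case: Z_pd.
have := lmi_ge0 (col_mx a1 b1); have := lmi_ge0 (col_mx a2 b2).
rewrite -!/(bilform _ _ _) !bilform_lmi // eq1 eq2 !bilformE.
rewrite (bilformC _ (G *m a2) (G *m a1) Z_sym) => ge2 ge1.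
have q1_ge0 := posdef_ge0 Z (G *m a1) Z_pd.
have q2_ge0 := posdef_ge0 Z (G *m a2) Z_pd.
have : bilform Z (G *m a1) (G *m a1) + bilform Z (G *m a2) (G *m a2) <= 0.
  rewrite -(nmulr_rge0 _ zr_lt0) mulrDr; lra.
by move=> q_le0; split; apply: (posdef_eq0 Z) => //; lra.
Qed.

Section ComplexVectors.
Context {R : realType}.

Definition Re_mx {m n} (v : 'M[R[i]]_(m, n)) : 'M[R]_(m, n) :=
  map_mx (@complex.Re R) v.
Definition Im_mx {m n} (v : 'M[R[i]]_(m, n)) : 'M[R]_(m, n) :=
  map_mx (@complex.Im R) v.

Lemma eq_mx_complex m n (u v : 'M[R[i]]_(m, n)) :
  Re_mx u = Re_mx v -> Im_mx u = Im_mx v -> u = v.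
Proof.
move=> /matrixP eqRe /matrixP eqIm; apply/matrixP => i j.
move: (eqRe i j) (eqIm i j); rewrite !mxE => eRe eIm.
by apply/eqP; rewrite eq_complex eRe eIm !eqxx.
Qed.

Lemma Re_mxZ m n z (v : 'M[R[i]]_(m, n)) :
  Re_mx (z *: v) = complex.Re z *: Re_mx v - complex.Im z *: Im_mx v.
Proof. by apply/matrixP => i j; rewrite !mxE; case: z (v i j) => ? ? []. Qed.

Lemma Im_mxZ m n z (v : 'M[R[i]]_(m, n)) :
  Im_mx (z *: v) = complex.Re z *: Im_mx v + complex.Im z *: Re_mx v.
Proof. by apply/matrixP => i j; rewrite !mxE; case: z (v i j) => ? ? []. Qed.

Lemma Re_mxB m n (u v : 'M[R[i]]_(m, n)) : Re_mx (u - v) = Re_mx u - Re_mx v.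
Proof. by apply/matrixP => i j; rewrite !mxE; case: (u i j) (v i j) => ? ? []. Qed.

Lemma Im_mxB m n (u v : 'M[R[i]]_(m, n)) : Im_mx (u - v) = Im_mx u - Im_mx v.
Proof. by apply/matrixP => i j; rewrite !mxE; case: (u i j) (v i j) => ? ? []. Qed.

Lemma Re_mx_mul m n p (A : 'M[R]_(m, n)) (v : 'M[R[i]]_(n, p)) :
  Re_mx (complex_mx A *m v) = A *m Re_mx v.
Proof.
apply/matrixP => i j; rewrite !mxE.
elim/big_rec2: _ => // k x y _ <-; rewrite !mxE.
by case: (v k j) y => ? ? [? ?] /=; rewrite mul0r subr0.
Qed.

Lemma Im_mx_mul m n p (A : 'M[R]_(m, n)) (v : 'M[R[i]]_(n, p)) :
  Im_mx (complex_mx A *m v) = A *m Im_mx v.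
Proof.
apply/matrixP => i j; rewrite !mxE.
elim/big_rec2: _ => // k x y _ <-; rewrite !mxE.
by case: (v k j) y => ? ? [? ?] /=; rewrite mul0r addr0.
Qed.

(* [v^* S v], provided that [S] is symmetric. *)
Definition hermform {n} (S : 'M[R]_n) (v : 'cV[R[i]]_n) : R :=
  bilform S (Re_mx v) (Re_mx v) + bilform S (Im_mx v) (Im_mx v).

(** The factor is the squared modulus of [z]; the mixed terms cancel by symmetry of [S]. *)
Lemma hermformZ n (S : 'M[R]_n) z (v : 'cV[R[i]]_n) : S^T = S ->
  hermform S (z *: v) =
    (complex.Re z ^+ 2 + complex.Im z ^+ 2) * hermform S v.
Proof.
move=> S_sym; rewrite /hermform Re_mxZ Im_mxZ !bilformE.
by rewrite (bilformC _ (Im_mx v) (Re_mx v) S_sym); ring.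
Qed.

Lemma hermform_ge0 n (S : 'M[R]_n) (v : 'cV[R[i]]_n) :
  possemidef S -> 0 <= hermform S v.
Proof. by move=> [_ S_ge0]; rewrite addr_ge0 // S_ge0. Qed.

Lemma hermform0 n (S : 'M[R]_n) : hermform S 0 = 0.
Proof.
have -> : (0 : 'cV[R[i]]_n) = 0 *: 0 by rewrite scaler0.
by rewrite /hermform Re_mxZ Im_mxZ /= !scale0r subr0 addr0 /bilform mulmx0 mxE addr0.
Qed.

(** The matrix inequality only speaks of real vectors, so the complex step from [b] to [a] is split
    into its two parts. This yields [G a = 0], and invertibility of [G] gives [a = 0]. *)
Lemma lmi_stage_eq0 s (B G Z W : 'M[R]_s) (z : R[i]) (a b : 'cV[R[i]]_s) :
  G \in unitmx -> posdef Z -> possemidef (lmi_mx B G Z W) ->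
  complex.Re z < 0 ->
  a - complex_mx B *m b = z *: (complex_mx G *m a) ->
  hermform W b <= hermform W a ->
  a = 0.
Proof.
move=> G_unit Z_pd lmi_psd z_lt0 eq_ab leW.
have eqRe := congr1 Re_mx eq_ab; have eqIm := congr1 Im_mx eq_ab.
rewrite Re_mxB Re_mxZ !Re_mx_mul !Im_mx_mul in eqRe.
rewrite Im_mxB Im_mxZ !Re_mx_mul !Im_mx_mul in eqIm.
have [GRe GIm] := lmi_kernel _ _ _ _ _ _ _ _ _ _ _ _ Z_pd lmi_psd z_lt0 eqRe eqIm leW.
have ker0 (x : 'cV[R]_s) : G *m x = 0 -> x = 0.
  by move=> Gx0; rewrite -(mulKmx G_unit x) Gx0 mulmx0.
apply: eq_mx_complex; rewrite (ker0 _ GRe, ker0 _ GIm);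
  by apply/matrixP => i j; rewrite !mxE.
Qed.

End ComplexVectors.

Lemma det0_col (F : fieldType) (n : nat) (A : 'M[F]_n) :
  \det A = 0 -> exists2 v : 'cV[F]_n, v != 0 & A *m v = 0.
Proof.
rewrite -det_tr => /eqP/det0P[v v_neq0 vA0].
exists v^T; first by rewrite trmx_eq0.
by apply: trmx_inj; rewrite trmx_mul trmxK vA0 trmx0.
Qed.

(** A row eigenvector makes the square matrix [A - mu%:M] singular, hence it has a column kernel
    vector as well. *)
Lemma eigenvalue_col (F : fieldType) (n : nat) (A : 'M[F]_n) (mu : F) :
  eigenvalue A mu -> exists2 v : 'cV[F]_n, A *m v = mu *: v & v != 0.
Proof.
move=> /eigenvalueP[u uA u_neq0].
have /det0_col[v v_neq0 Av] : \det (A - mu%:M) = 0.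
  apply/eqP/det0P; exists u => //.
  by rewrite mulmxBr uA mul_mx_scalar subrr.
exists v => //; apply: subr0_eq.
by rewrite -mul_scalar_mx -mulmxBl.
Qed.

(** A strict bound on every element need not pass to a supremum; here it does because the spectrum
    is finite. *)
Lemma spectral_radius_lt (R : realType) (n : nat) (M : 'M[R[i]]_n) (c : R) :
  0 < c ->
  (forall mu, eigenvalue M mu -> ComplexField.Normc.normc mu < c) ->
  spectral_radius M < c.
Proof.
move=> c_gt0 eigM_lt; rewrite /spectral_radius; set E := [set _ | _ in _]%classic.
(* An empty spectrum has [sup] equal to 0, which is below [c]. *)
have [-> | /set0P E_neq0] := eqVneq E set0; first by rewrite sup0.
(* The characteristic polynomial splits over [R[i]], so the list [r] of its roots contains all
   eigenvalues and the supremum is bounded by a finite maximum. *)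
have [r char_eq] := closed_field_poly_normal (char_poly M).
rewrite (monicP (char_poly_monic M)) scale1r in char_eq.
have bound_lt : \big[Num.max/0]_(mu <- r | eigenvalue M mu)
    ComplexField.Normc.normc mu < c by apply: bigmax_lt.
apply: le_lt_trans bound_lt; apply: ge_sup => // _ [mu /= eig_mu <-].
apply: le_bigmax_seq => //.
by move: eig_mu; rewrite eigenvalue_root_char char_eq root_prod_XsubC.
Qed.

Theorem theorem2p5 (R : realType) (s : nat) (P : peer_method R s) :
  (0 < s)%N ->
  stiffly_accurate P ->
  peerG P \in unitmx ->
  (exists Z W : 'M[R]_s,
     [/\ posdef Z, possemidef W & possemidef (lmi_mx (peerB P) (peerG P) Z W)]) ->
  A_stable P.
Proof.
move=> _ P_sa G_unit [Z [W [Z_pd W_psd lmi_psd]]] z z_lt0.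
have stage0 := lmi_stage_eq0 _ _ _ _ _ z _ _ G_unit Z_pd lmi_psd z_lt0.
have stageE (v : 'cV_s) : stage_mx P z *m v = v - z *: (complex_mx (peerG P) *m v).
  by rewrite mulmxBl mul1mx -scalemxAl.
have stage_unit : stage_mx P z \in unitmx.
  rewrite unitmxE unitfE; apply/eqP => /det0_col[v + stage_v].
  case/eqP; move: stage_v; rewrite stageE => /subr0_eq v_eq.
  apply: (stage0 v 0); first by rewrite mulmx0 subr0.
  by rewrite hermform0 hermform_ge0.
split=> //; rewrite stability_mx_stiffly_accurate //.
apply: spectral_radius_lt => // mu /eigenvalue_col[v Mv v_neq0].
rewrite ltNge; apply/negP => mu_ge1.
have muv0 : mu *: v = 0.
  apply: (stage0 _ v).
    (* Rearranged, the goal says that the stage matrix sends [mu *: v] to [B v]; this follows from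
       [Mv] by cancelling the inverse. *)
    apply/eqP; rewrite subr_eq addrC -subr_eq -stageE -Mv mulmxA.
    by rewrite mulKVmx.
  rewrite hermformZ; last by case: W_psd.
  rewrite ler_peMl ?hermform_ge0 //.
  case: mu mu_ge1 {Mv} => x y /= norm_ge1.
  (* The scaling factor is the square of the modulus of [mu], hence at least 1. *)
  by rewrite -[leRHS]sqr_sqrtr ?addr_ge0 ?sqr_ge0 // exprn_ege1.
move/eqP: muv0; rewrite scaler_eq0 (negPf v_neq0) orbF => /eqP mu0.
by move: mu_ge1; rewrite mu0 /= expr0n /= addr0 sqrtr0 ler10.
Qed.
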